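(* Let $\mathcal{X}$ be a Polish space, $\mu_0\in\mathcal{P}(\mathcal{X})$, let $\mathcal{H}\subseteq C_b(\mathcal{X})$ be a linear space containing the constant functions, and assume that $\phi(f)=\inf\{\int h\,d\mu_0 : h\in\mathcal{H},\ h\ge f\}$, $f\in C_b(\mathcal{X})$, is continuous from above. Let $\mathcal{H}^1\subseteq\mathcal{H}^2\subseteq\cdots$ be a sequence of subsets of $\mathcal{H}$ and $\mathcal{H}^\infty=\bigcup_{m\in\mathbb{N}}\mathcal{H}^m$. For $m\in\mathbb{N}\cup\{\infty\}$ let $\phi^m(f)=\inf\{\int h\,d\mu_0 : h\in\mathcal{H}^m,\ h\ge f\}$. Assume that $\mathcal{H}^\infty$ is a linear space which contains the constants and that Condition (D) (stated in the context) holds. Then $$\lim_{m\to\infty}\phi^m(f)=\phi^\infty(f)=\phi(f)\qquad\text{for all }f\in C_b(\mathcal{X}).$$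
   Context: $\mathcal{P}(\mathcal{X})$ is the set of Borel probability measures on $\mathcal{X}$; $C_b(\mathcal{X})$ is the space of continuous bounded functions $\mathcal{X}\to\mathbb{R}$; inequalities between functions are pointwise; $\inf\emptyset=+\infty$. Continuity from above of $\phi$ means: $\phi(f_n)\downarrow 0$ for every sequence $(f_n)$ in $C_b(\mathcal{X})$ with $f_n\downarrow 0$ pointwise. Condition (D): for every $\varepsilon>0$ and every $\mu\in\mathcal{P}(\mathcal{X})$, (a) for every $h\in\mathcal{H}$ there exists $h'\in\mathcal{H}^\infty$ such that $\int|h-h'|\,d\mu\le\varepsilon$; (b) there exists $h''\in\mathcal{H}^\infty$ such that $1_{K^c}\le h''$ and $\int h''\,d\mu\le\varepsilon$ for some compact subset $K$ of $\mathcal{X}$. *)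

(* Defs.v *)
From HB Require Import structures.
From mathcomp Require Import all_boot all_order all_algebra.
From mathcomp Require Import all_classical all_reals all_analysis.

Set Implicit Arguments.
Unset Strict Implicit.
Unset Printing Implicit Defensive.

Import Order.TTheory GRing.Theory Num.Theory.
Import numFieldNormedType.Exports.

Local Open Scope classical_set_scope.
Local Open Scope ring_scope.

(* The metric is only required to exist: being Polish is a property of the
   topology. *)
Definition polish_space (R : realType) (X : topologicalType) : Prop :=
  (exists d : X -> X -> R,
    [/\ forall x y, d x y = 0 <-> x = y,
        forall x y, d x y = d y x,
        forall x y z, d x z <= d x y + d y z,
        forall (x : X) (A : set X),
          nbhs x A <-> exists2 e : R, 0 < e & [set y | d x y < e] `<=` A
      & forall u : nat -> X,
          (forall e : R, 0 < e -> exists N : nat, forall m n : nat,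
             (N <= m)%N -> (N <= n)%N -> d (u m) (u n) < e) ->
          exists l : X, u @ \oo --> l])
  /\ exists2 D : set X, countable D & dense D.

(* The base point is required by measurableType; it is no restriction here,
   since a space carrying a probability measure is nonempty. *)
Definition borel (X : ptopologicalType) := g_sigma_algebraType (@open X).

Definition Cb (R : realType) (X : topologicalType) : set (X -> R) :=
  [set f | continuous f /\ bounded_fun f].
Arguments Cb : clear implicits.

Definition linear_space (R : realType) (X : Type) (H : set (X -> R)) : Prop :=
  [/\ H (cst 0),
      forall f g, H f -> H g -> H (f \+ g)
    & forall (a : R) f, H f -> H (fun x => a * f x)].

Definition contains_constants (R : realType) (X : Type) (H : set (X -> R)) :=
  forall c : R, H (cst c).

(* Extended-real valued, so that the infimum over the empty set is +oo. *)
Definition phi (R : realType) (X : ptopologicalType)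
    (mu0 : probability (borel X) R) (H : set (X -> R)) (f : X -> R) : \bar R :=
  ereal_inf [set (\int[mu0]_(x in [set: borel X]) (h x)%:E)%E |
              h in [set h | H h /\ forall x, f x <= h x]].

Definition continuous_from_above (R : realType) (X : ptopologicalType)
    (Phi : (X -> R) -> \bar R) : Prop :=
  forall f_ : nat -> X -> R,
    (forall n, Cb R X (f_ n)) ->
    (forall x, nonincreasing_seq (fun n => f_ n x)) ->
    (forall x, f_ n x @[n --> \oo] --> (0 : R)) ->
    nonincreasing_seq (fun n => Phi (f_ n)) /\
    Phi (f_ n) @[n --> \oo] --> 0%E.

Definition condition_D (R : realType) (X : ptopologicalType)
    (H Hoo : set (X -> R)) : Prop :=
  forall (eps : R) (mu : probability (borel X) R), 0 < eps ->
    (forall h, H h -> exists2 h', Hoo h' &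
       (\int[mu]_(x in [set: borel X]) `|h x - h' x|%:E <= eps%:E)%E) /\
    (exists2 h'', Hoo h'' & exists K : set X,
       [/\ compact K,
           forall x, \1_(~` K) x <= h'' x
         & (\int[mu]_(x in [set: borel X]) (h'' x)%:E <= eps%:E)%E]).

(* Main.v *)
Require Import Defs.
From HB Require Import structures.
From mathcomp Require Import all_boot all_order all_algebra.
From mathcomp Require Import all_classical all_reals all_analysis.
From mathcomp Require Import measurable_realfun.
From mathcomp Require Import ring lra.

Set Implicit Arguments.
Unset Strict Implicit.
Unset Printing Implicit Defensive.

Import Order.TTheory GRing.Theory Num.Theory.
Import numFieldNormedType.Exports.

Local Open Scope classical_set_scope.
Local Open Scope ring_scope.

(* Let p be the superhedging price over Hoo under mu0, a sublinear functional on
   Cb. By Hahn-Banach some linear L <= p has L f = p f; it is positive and agrees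
   with mu0 on Hoo. Part (b) of Condition (D) at mu0 makes L tight, hence, by Dini,
   continuous along sequences decreasing to 0, so L is a Daniell integral. The
   average of L and mu0 is then integration against a Borel probability nu, and
   part (a) of Condition (D) at nu approximates any h in H by h' in Hoo
   simultaneously for L and for mu0, so that L agrees with mu0 on H. Therefore
   p f = L f <= L h = mu0(h) for all h in H with h >= f. *)

(** * Lower bounds for sums and multiples of real infima *)

Section infimum.
Context {R : realType}.
Implicit Types (S T : set R) (a c : R).

Lemma le_infD S T c : S !=set0 -> T !=set0 ->
  (forall s t, S s -> T t -> c <= s + t) -> c <= inf S + inf T.
Proof.
move=> S0 T0 le_c; rewrite -lerBlDl; apply: lb_le_inf => // t Tt.
rewrite lerBlDl -lerBlDr; apply: lb_le_inf => // s Ss.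
by rewrite lerBlDr le_c.
Qed.

Lemma le_infZ S a c : 0 <= a -> S !=set0 ->
  (forall s, S s -> c <= a * s) -> c <= a * inf S.
Proof.
rewrite le_eqVlt => /predU1P[<- [s Ss] /(_ s Ss)|a0 S0 le_c]; first by rewrite !mul0r.
rewrite -ler_pdivrMl//; apply: lb_le_inf => // s Ss.
by rewrite ler_pdivrMl// le_c.
Qed.

End infimum.

(** * The Hahn-Banach theorem through minimal sublinear functionals *)

Section hahn_banach.
Context {R : realType} {X : Type}.
Implicit Types (V : set (X -> R)) (p q : (X -> R) -> R) (f g y : X -> R).

Definition linear_on V p :=
  (forall f g, V f -> V g -> p (f \+ g) = p f + p g) /\
  (forall a f, V f -> p (fun x => a * f x) = a * p f).

(** Homogeneity is asked only as an inequality, which passes to infima directly; [sublinear_scale]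
    recovers the other one. *)
Definition sublinear_on V p :=
  (forall f g, V f -> V g -> p (f \+ g) <= p f + p g) /\
  (forall a f, 0 <= a -> V f -> p (fun x => a * f x) <= a * p f).

(** Subadditivity gives [0 <= p 0 <= p f + p (- f)]. The resulting bound keeps the infimum over a
    chain of sublinear functionals finite. *)
Lemma sublinear_ge V p f : linear_space V -> sublinear_on V p -> V f ->
  - p (fun x => -1 * f x) <= p f.
Proof.
move=> [V0 _ VZ] [pD pZ] Vf.
have p0 : 0 <= p (cst 0).
  have := pD _ _ V0 V0.
  have -> : cst (0 : R) \+ cst 0 = cst 0 :> (X -> R) by apply/funext => x /=; ring.
  lra.
have := pD _ _ Vf (VZ (-1) _ Vf).
have -> : f \+ (fun x => -1 * f x) = cst 0 by apply/funext => x /=; ring.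
lra.
Qed.

(** For [t > 0], apply the homogeneity inequality to [t f] with the factor [t^-1]; for [t = 0] the
    claim is [0 <= p 0]. *)
Lemma sublinear_scale V p f t : linear_space V -> sublinear_on V p -> V f ->
  0 <= t -> t * p f <= p (fun x => t * f x).
Proof.
move=> Vl [pD pZ] Vf; have [V0 VD VZ] := Vl.
rewrite le_eqVlt => /predU1P[<-|t0].
  have -> : (fun x => 0 * f x) = cst 0 by apply/funext => x /=; ring.
  have := pD _ _ V0 V0.
  have -> : cst (0 : R) \+ cst 0 = cst 0 :> (X -> R) by apply/funext => x /=; ring.
  lra.
rewrite -ler_pdivlMl//.
have := pZ t^-1 _ _ (VZ t _ Vf); rewrite invr_ge0 (ltW t0) => /(_ isT).
have -> // : (fun x => t^-1 * (t * f x)) = f.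
by apply/funext => x; rewrite mulKf// gt_eqF.
Qed.

(* The largest sublinear functional below [p] that is linear on the line through
   [y] and agrees with [p] at [y]. *)
Definition linearize_along p y : (X -> R) -> R := fun f =>
  inf [set p (fun x => f x + t * y x) - t * p y | t in [set t | 0 <= t]].

Section linearize_along.
Variables (V : set (X -> R)) (p : (X -> R) -> R) (y : X -> R).
Hypotheses (Vl : linear_space V) (ps : sublinear_on V p) (Vy : V y).

Let has_lb f : V f ->
  has_lbound [set p (fun x => f x + t * y x) - t * p y | t in [set t | 0 <= t]].
Proof.
(* This bound does not depend on [t], because [t * p y <= p (t y) <= p (f + t y) + p (- f)]. *)
move=> Vf; exists (- p (fun x => -1 * f x)) => _ [t /= t0 <-].
have [V0 VD VZ] := Vl; have [pD pZ] := ps.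
have := pD _ _ (VD _ _ Vf (VZ t _ Vy)) (VZ (-1) _ Vf).
have -> : (f \+ (fun x => t * y x)) \+ (fun x => -1 * f x) = (fun x => t * y x).
  by apply/funext => x /=; ring.
have := sublinear_scale Vl ps Vy t0.
rewrite /GRing.add_fun; lra.
Qed.

Lemma linearize_along_le_ray f t : V f -> 0 <= t ->
  linearize_along p y f <= p (fun x => f x + t * y x) - t * p y.
Proof. by move=> Vf t0; apply: ge_inf; [exact: has_lb|exists t]. Qed.

Lemma linearize_along_le f : V f -> linearize_along p y f <= p f.
Proof.
move=> Vf; have := @linearize_along_le_ray _ 0 Vf (lexx _).
rewrite mul0r subr0; congr (_ <= p _).
by apply/funext => x; rewrite mul0r addr0.
Qed.

(** The value [t = 1] in the infimum gives [p 0 - p y]. This is what later forces the linear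
    minorant to reach [p y] at [y]. *)
Lemma linearize_along_opp : linearize_along p y (fun x => -1 * y x) <= - p y.
Proof.
have [V0 VD VZ] := Vl; have [pD pZ] := ps.
have := linearize_along_le_ray (VZ (-1) _ Vy) (ler01 : 0 <= 1 :> R).
have -> : (fun x => -1 * y x + 1 * y x) = (fun x => 0 * y x).
  by apply/funext => x; ring.
have := pZ _ _ (lexx 0) Vy; lra.
Qed.

(** Parameters [s] for [f] and [t] for [g] combine to [s + t] for [f + g], and [t] for [f] becomes
    [a * t] for [a f]. *)
Lemma linearize_along_sublinear : sublinear_on V (linearize_along p y).
Proof.
have [V0 VD VZ] := Vl; have [pD pZ] := ps.
have ne f :
    [set p (fun x => f x + t * y x) - t * p y | t in [set t | 0 <= t]] !=set0.
  by exists (p (fun x => f x + 0 * y x) - 0 * p y), 0 => /=.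
split=> [f g Vf Vg|a f a0 Vf].
- apply: le_infD => // _ _ [s /= s0 <-] [t /= t0 <-].
  have st0 : 0 <= s + t by exact: addr_ge0.
  have := linearize_along_le_ray (VD _ _ Vf Vg) st0.
  have := pD _ _ (VD _ _ Vf (VZ s _ Vy)) (VD _ _ Vg (VZ t _ Vy)).
  rewrite /GRing.add_fun.
  have -> : (fun x => f x + s * y x + (g x + t * y x)) =
    (fun x => f x + g x + (s + t) * y x) by apply/funext => x; ring.
  lra.
- apply: le_infZ => // _ [t /= t0 <-].
  have at0 : 0 <= a * t by exact: mulr_ge0.
  have := linearize_along_le_ray (VZ a _ Vf) at0.
  have := pZ _ _ a0 (VD _ _ Vf (VZ t _ Vy)).
  rewrite /GRing.add_fun.
  have -> : (fun x => a * (f x + t * y x)) = (fun x => a * f x + a * t * y x).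
    by apply/funext => x; ring.
  lra.
Qed.

End linearize_along.

(** Zorn's lemma. The pointwise infimum of a chain is subadditive because any two members are
    comparable, so the smaller one serves for both summands. *)
Lemma exists_minimal_sublinear V p : linear_space V -> sublinear_on V p ->
  exists q, [/\ sublinear_on V q, forall f, V f -> q f <= p f &
    forall r, sublinear_on V r -> (forall f, V f -> r f <= q f) ->
      forall f, V f -> q f <= r f].
Proof.
move=> Vl ps; have [V0 VD VZ] := Vl.
pose T := {q | sublinear_on V q /\ forall f, V f -> q f <= p f}.
(* The order is reversed, so that maximal means minimal. It compares values on [V] only and is
   therefore a mere preorder. *)
pose leT (q r : T) := `[< forall f, V f -> sval r f <= sval q f >].
have [||C totC|[q [qs qp]] qmin] := @ZL_preorder T (exist _ p (conj ps (fun _ _ => lexx _))) leT.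
- by move=> q; apply/asboolP.
- move=> q r s /asboolP qr /asboolP rs; apply/asboolP => f Vf.
  exact: le_trans (rs f Vf) (qr f Vf).
- have [[q0 Cq0]|C0] := pselect (C !=set0); last first.
    by exists (exist _ p (conj ps (fun _ _ => lexx _))) => s Cs; case: C0; exists s.
  pose r f := inf [set sval q f | q in C].
  have ne f : [set sval q f | q in C] !=set0 by exists (sval q0 f), q0.
  have r_le f (q : T) : V f -> C q -> r f <= sval q f.
    move=> Vf Cq; apply: ge_inf; last by exists q.
    exists (- p (fun x => -1 * f x)) => _ [[s [ss sp]] Cs <-] /=.
    apply: le_trans (sublinear_ge Vl ss Vf); rewrite lerN2.
    exact: sp (VZ _ _ Vf).
  have rs : sublinear_on V r.
    split=> [f g Vf Vg|a f a0 Vf].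
    + apply: le_infD => // _ _ [q Cq <-] [s Cs <-].
      have Vfg := VD _ _ Vf Vg.
      have [/asboolP sq|/asboolP qs] := totC _ _ Cq Cs.
      * apply: le_trans (r_le _ _ Vfg Cs) _.
        apply: le_trans ((svalP s).1.1 _ _ Vf Vg) _.
        by rewrite lerD2r sq.
      * apply: le_trans (r_le _ _ Vfg Cq) _.
        apply: le_trans ((svalP q).1.1 _ _ Vf Vg) _.
        by rewrite lerD2l qs.
    + apply: le_infZ => // _ [q Cq <-].
      apply: le_trans (r_le _ _ (VZ a _ Vf) Cq) _.
      exact: (svalP q).1.2.
  have rp f : V f -> r f <= p f.
    by move=> Vf; apply: le_trans (r_le _ _ Vf Cq0) ((svalP q0).2 f Vf).
  exists (exist _ r (conj rs rp)) => q Cq; apply/asboolP => f Vf /=.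
  exact: r_le.
- exists q; split=> // r rs rq f Vf.
  have rp g : V g -> r g <= p g by move=> Vg; exact: le_trans (rq g Vg) (qp g Vg).
  have /asboolP := qmin (exist _ r (conj rs rp)) (asboolT rq).
  exact.
Qed.

(** Minimality against [linearize_along q g] gives [q f <= q (f + g) - q g], the missing half of
    additivity; additivity then yields negative scalars. *)
Lemma minimal_sublinear_linear V q : linear_space V -> sublinear_on V q ->
  (forall r, sublinear_on V r -> (forall f, V f -> r f <= q f) ->
      forall f, V f -> q f <= r f) ->
  linear_on V q.
Proof.
move=> Vl qs qmin; have [V0 VD VZ] := Vl; have [qD qZ] := qs.
have qDE f g : V f -> V g -> q (f \+ g) = q f + q g.
  move=> Vf Vg; apply/eqP; rewrite eq_le qD//=.
  have := qmin _ (linearize_along_sublinear Vl qs Vg)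
    (fun h Vh => linearize_along_le Vl qs Vg Vh) f Vf.
  have := linearize_along_le_ray Vl qs Vg Vf (ler01 : 0 <= 1 :> R).
  have -> : (fun x => f x + 1 * g x) = f \+ g by apply/funext => x /=; ring.
  lra.
have qZE a f : 0 <= a -> V f -> q (fun x => a * f x) = a * q f.
  by move=> a0 Vf; apply/eqP; rewrite eq_le qZ//= (sublinear_scale Vl).
have q0 : q (cst 0) = 0.
  have := qDE _ _ V0 V0.
  have -> : cst (0 : R) \+ cst 0 = cst 0 :> (X -> R) by apply/funext => x /=; ring.
  lra.
split=> // a f Vf; have [a0|a0] := leP 0 a; first exact: qZE.
have Na0 : 0 <= - a by rewrite oppr_ge0 ltW.
have := qDE _ _ (VZ a _ Vf) (VZ (- a) _ Vf).
have -> : (fun x => a * f x) \+ (fun x => - a * f x) = cst 0.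
  by apply/funext => x /=; ring.
rewrite q0 (qZE _ _ Na0 Vf); lra.
Qed.

(** The minimal functional is taken below [linearize_along p y] instead of [p]: then
    [L (- y) <= - p y], hence [L y = p y]. *)
Theorem hahn_banach V p y : linear_space V -> sublinear_on V p -> V y ->
  exists L, [/\ linear_on V L, forall f, V f -> L f <= p f & L y = p y].
Proof.
move=> Vl ps Vy; have [V0 VD VZ] := Vl.
have [L [Ls Lle Lmin]] :=
  exists_minimal_sublinear Vl (linearize_along_sublinear Vl ps Vy).
have LL := minimal_sublinear_linear Vl Ls Lmin.
have Lp f : V f -> L f <= p f.
  by move=> Vf; apply: le_trans (Lle f Vf) (linearize_along_le Vl ps Vy Vf).
exists L; split=> //; apply/eqP; rewrite eq_le Lp//=.
have := le_trans (Lle _ (VZ (-1) _ Vy)) (linearize_along_opp Vl ps Vy).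
rewrite LL.2//; lra.
Qed.

End hahn_banach.

(** * Algebraic and lattice operations on bounded continuous functions *)

Section Cb.
Context {R : realType} {X : topologicalType}.
Implicit Types f g : X -> R.

Lemma CbP f : Cb R X f <-> continuous f /\ exists M, forall x, `|f x| <= M.
Proof.
split=> -[cf]; first by case=> M [_ fM]; split=> //; exists (M + 1) => x;
  apply: fM => //; rewrite ltrDl.
case=> M fM; split=> //; exists M; split; first exact: num_real.
by move=> N MN x _; exact: le_trans (fM x) (ltW MN).
Qed.

Lemma Cb_bounds f : Cb R X f -> exists2 M, 0 < M & forall x, - M <= f x <= M.
Proof.
move=> /CbP[_ [M fM]]; exists (`|M| + 1) => [|x]; first exact: ltr_wpDl.
rewrite -ler_norml (le_trans (fM x))// (le_trans (ler_norm M))//.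
by rewrite lerDl.
Qed.

Lemma Cb_cst (c : R) : Cb R X (cst c).
Proof. by apply/CbP; split; [exact: cst_continuous|exists `|c|]. Qed.

Lemma Cb_add f g : Cb R X f -> Cb R X g -> Cb R X (f \+ g).
Proof.
move=> /CbP[cf [M fM]] /CbP[cg [N gN]]; apply/CbP; split.
  by move=> x; apply: cvgD; [exact: cf|exact: cg].
by exists (M + N) => x; apply: le_trans (ler_normD _ _) (lerD _ _).
Qed.

Lemma Cb_mul f g : Cb R X f -> Cb R X g -> Cb R X (f \* g).
Proof.
move=> /CbP[cf [M fM]] /CbP[cg [N gN]]; apply/CbP; split.
  by move=> x; apply: cvgM; [exact: cf|exact: cg].
by exists (M * N) => x /=; rewrite normrM ler_pM.
Qed.

Lemma Cb_scale (a : R) f : Cb R X f -> Cb R X (fun x => a * f x).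
Proof. by move=> Cf; apply: (Cb_mul (Cb_cst a)). Qed.

Lemma Cb_sub f g : Cb R X f -> Cb R X g -> Cb R X (fun x => f x - g x).
Proof.
move=> Cf Cg; have := Cb_add Cf (Cb_scale (-1) Cg); congr (Cb _ _ _).
by apply/funext => x /=; rewrite mulN1r.
Qed.

Lemma Cb_min f g : Cb R X f -> Cb R X g -> Cb R X (f \min g).
Proof.
move=> /CbP[cf [M fM]] /CbP[cg [N gN]]; apply/CbP; split.
  by move=> x; apply: continuous_min; [exact: cf|exact: cg].
by exists (Num.max M N) => x /=; rewrite minEle le_max; case: ifP; rewrite ?fM ?gN ?orbT.
Qed.

Lemma Cb_max f g : Cb R X f -> Cb R X g -> Cb R X (f \max g).
Proof.
move=> /CbP[cf [M fM]] /CbP[cg [N gN]]; apply/CbP; split.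
  by move=> x; apply: continuous_max; [exact: cf|exact: cg].
by exists (Num.max M N) => x /=; rewrite maxEle le_max; case: ifP; rewrite ?fM ?gN ?orbT.
Qed.

Lemma Cb_norm f : Cb R X f -> Cb R X (fun x => `|f x|).
Proof.
move=> /CbP[cf [M fM]]; apply/CbP; split.
  by move=> x; apply: cvg_norm; exact: cf.
by exists M => x; rewrite normr_id.
Qed.

Lemma Cb_linear_space : linear_space (Cb R X).
Proof.
split; [exact: Cb_cst|exact: Cb_add|by move=> a f; exact: Cb_scale].
Qed.

Lemma Cb_sum n (u : nat -> X -> R) : (forall m, Cb R X (u m)) ->
  Cb R X (fun x => \sum_(m < n) u m x).
Proof.
move=> Cu; elim: n => [|n IH].
  by have := Cb_cst 0; congr (Cb _ _ _); apply/funext => x; rewrite big_ord0.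
have := Cb_add IH (Cu n); congr (Cb _ _ _).
by apply/funext => x /=; rewrite big_ord_recr.
Qed.

End Cb.

(** * Integration of bounded continuous functions against a Borel probability *)

Section integral_Cb.
Context {R : realType} {X : ptopologicalType} (mu : probability (borel X) R).
Implicit Types f g : X -> R.

Lemma Cb_measurable f : Cb R X f -> measurable_fun [set: borel X] f.
Proof.
move=> /CbP[/continuousP cf _].
apply: (measurability _ (RGenOpens.measurableE R)) => _ [_ [a [b ->] <-]].
rewrite setTI; apply: sub_sigma_algebra; apply: cf; exact: interval_open.
Qed.

Lemma Cb_integrable f : Cb R X f -> mu.-integrable [set: borel X] (EFin \o f).
Proof.
move=> Cf; apply: measurable_bounded_integrable => //.
- by rewrite ltey_eq fin_num_measure.
- exact: Cb_measurable.
- by case: Cf.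
Qed.

Definition expect f : R := \int[mu]_(x in [set: borel X]) f x.

Lemma expectE f : Cb R X f ->
  (\int[mu]_(x in [set: borel X]) (f x)%:E)%E = (expect f)%:E.
Proof.
move=> Cf; rewrite /expect /Rintegral fineK//.
exact: (integrable_fin_num _ (Cb_integrable Cf)).
Qed.

Lemma expect_linear : linear_on (Cb R X) expect.
Proof.
split=> [f g Cf Cg|a f Cf]; rewrite /expect.
- by rewrite RintegralD//; exact: Cb_integrable.
- by rewrite RintegralZl//; exact: Cb_integrable.
Qed.

Lemma expect_le f g : Cb R X f -> Cb R X g -> (forall x, f x <= g x) ->
  expect f <= expect g.
Proof. by move=> Cf Cg fg; apply: le_Rintegral => //; exact: Cb_integrable. Qed.

Lemma expect_cst c : expect (cst c) = c.
Proof.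
rewrite /expect Rintegral_cst//.
by have := probability_setT mu => /= ->; rewrite mulr1.
Qed.

End integral_Cb.

(** * The Daniell outer measure of a positive normalized linear functional *)

(** Both limits are expressed by falling below every positive level once, which amounts to
    convergence to 0 for decreasing nonnegative sequences and positive [L]. *)
Definition daniell_continuous (R : realType) (X : topologicalType)
    (L : (X -> R) -> R) :=
  forall u : nat -> X -> R,
    (forall n, Cb R X (u n)) -> (forall n x, 0 <= u n x) ->
    (forall x, {homo u ^~ x : m n / (m <= n)%N >-> n <= m}) ->
    (forall x e, 0 < e -> exists n, u n x <= e) ->
    forall e, 0 < e -> exists n, L (u n) <= e.

Section daniell.
Context {R : realType} {X : topologicalType}.
Variable L : (X -> R) -> R.
Hypothesis L_linear : linear_on (Cb R X) L.
Hypothesis L_ge0 : forall f, Cb R X f -> (forall x, 0 <= f x) -> 0 <= L f.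
Hypothesis L1 : L (cst 1) = 1.

Lemma functional_sub f g : Cb R X f -> Cb R X g ->
  L (fun x => f x - g x) = L f - L g.
Proof.
move=> Cf Cg; rewrite -mulN1r -L_linear.2// -L_linear.1//.
- by congr L; apply/funext => x /=; rewrite mulN1r.
- exact: Cb_scale.
Qed.

Lemma functional_le f g : Cb R X f -> Cb R X g -> (forall x, f x <= g x) ->
  L f <= L g.
Proof.
move=> Cf Cg fg; rewrite -subr_ge0 -functional_sub// L_ge0//.
- exact: Cb_sub.
- by move=> x; rewrite subr_ge0.
Qed.

Lemma functional_cst c : L (cst c) = c.
Proof.
have -> : cst c = (fun x : X => c * cst 1 x) by apply/funext => x; rewrite mulr1.
by rewrite L_linear.2 ?L1 ?mulr1//; exact: Cb_cst.
Qed.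

Lemma functional_sum n (u : nat -> X -> R) : (forall m, Cb R X (u m)) ->
  L (fun x => \sum_(m < n) u m x) = \sum_(m < n) L (u m).
Proof.
move=> Cu; elim: n => [|n IH].
  rewrite big_ord0 -[RHS](functional_cst 0); congr L.
  by apply/funext => x; rewrite big_ord0.
rewrite big_ord_recr/= -IH -L_linear.1//; last exact: Cb_sum.
by congr L; apply/funext => x; rewrite big_ord_recr.
Qed.

(* Daniell outer measure; increasing sequences stand for the partial sums of the
   usual covering series, so that no double series occurs. *)
Definition covered (A : set X) (c : R) := exists u : nat -> X -> R,
  [/\ forall n, Cb R X (u n), forall n x, 0 <= u n x,
      forall x, {homo u ^~ x : m n / (m <= n)%N >-> m <= n},
      forall x, A x -> exists n, 1 <= u n x & forall n, L (u n) <= c].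

Lemma covered_ge0 A c : covered A c -> 0 <= c.
Proof. by move=> [u [Cu u0 _ _ /(_ 0%N)]]; apply: le_trans; apply: L_ge0. Qed.

Lemma covered_cst1 A : covered A 1.
Proof.
exists (fun=> cst 1); split=> //.
- by move=> _; exact: Cb_cst.
- by move=> x n p _; exact: lexx.
- by move=> x Ax; exists 0%N.
- by move=> _; rewrite L1.
Qed.

Definition outer_content (A : set X) : R := inf [set c | covered A c].

Lemma outer_content_le A c : covered A c -> outer_content A <= c.
Proof. by move=> Ac; apply: ge_inf => //; exists 0 => b; exact: covered_ge0. Qed.

Lemma le_outer_content A b : (forall c, covered A c -> b <= c) ->
  b <= outer_content A.
Proof. by move=> Ab; apply: lb_le_inf => //; exists 1; exact: covered_cst1. Qed.

Lemma outer_content_ge0 A : 0 <= outer_content A.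
Proof. by apply: le_outer_content => c; exact: covered_ge0. Qed.

Lemma outer_content0 : outer_content set0 = 0.
Proof.
apply/eqP; rewrite eq_le outer_content_ge0 andbT; apply: outer_content_le.
exists (fun=> cst 0); split=> //.
- by move=> _; exact: Cb_cst.
- by move=> x n p _; exact: lexx.
- by move=> _; rewrite functional_cst.
Qed.

Lemma outer_content_mono A B : A `<=` B -> outer_content A <= outer_content B.
Proof.
move=> AB; apply: le_outer_content => c [u [Cu u0 ui uB Lu]].
by apply: outer_content_le; exists u; split=> // x /AB; exact: uB.
Qed.

Lemma outer_content_adherent A e : 0 < e ->
  exists2 c, covered A c & c < outer_content A + e.
Proof.
move=> e0; have [|c Ac ce] := @inf_adherent _ [set c | covered A c] _ e0.
  split; first by exists 1; exact: covered_cst1.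
  by exists 0 => b; exact: covered_ge0.
by exists c.
Qed.

(** A diagonal choice: the index [n] both truncates the sum and advances every cover, so the new
    sequence is again increasing. *)
Lemma covered_bigcup (A : nat -> set X) (c : nat -> R) C :
  (forall m, covered (A m) (c m)) -> (forall n, \sum_(m < n) c m <= C) ->
  covered (\bigcup_m A m) C.
Proof.
move=> /choice[u uP] cC.
have Cu m n : Cb R X (u m n) by have [] := uP m.
have u0 m n x : 0 <= u m n x by have [_ ] := uP m.
have ui m x n p : (n <= p)%N -> u m n x <= u m p x.
  by have [_ _ ui _ _] := uP m; exact: ui.
exists (fun n x => \sum_(m < n) u m n x); split.
- by move=> n; apply: (@Cb_sum _ _ n (u^~ n)).
- by move=> n x; exact: sumr_ge0.
- move=> x n p np; rewrite (big_ord_widen _ (fun m => u m n x) np) big_mkcond.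
  by apply: ler_sum => i _; case: ifP => _; rewrite ?ui.
- move=> x [m _ Amx]; have [_ _ _ uA _] := uP m; have [n un] := uA x Amx.
  (* The index must exceed [m] for the cover of [A m] to occur in the sum, and reach [n] for that
     cover to be at least 1 at [x]. *)
  exists (maxn n m.+1).
  rewrite (bigD1 (Ordinal (leq_maxr n m.+1)))//= ler_wpDr ?sumr_ge0//.
  by apply: le_trans un _; rewrite ui// leq_maxl.
- move=> n; rewrite (@functional_sum n (u^~ n))//; apply: le_trans (cC n).
  by apply: ler_sum => m _; have [_ _ _ _] := uP m.
Qed.

Lemma outer_content_sigma_subadditive :
  sigma_subadditive (fun A => (outer_content A)%:E).
Proof.
move=> A; have [|] := ltP (\sum_(i <oo) (outer_content (A i))%:E)%E +oo%E; last first.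
  by rewrite leye_eq => /eqP ->; rewrite leey.
have S0 : (0 <= \sum_(i <oo) (outer_content (A i))%:E)%E.
  by apply: nneseries_ge0 => n _ _; rewrite lee_fin outer_content_ge0.
move=> Sfin; apply/lee_addgt0Pr => e e0.
have Sn n : (\sum_(m < n) (outer_content (A m))%:E <=
    \sum_(i <oo) (outer_content (A i))%:E)%E.
  rewrite -(big_mkord xpredT (fun m => (outer_content (A m))%:E)).
  by apply: nneseries_lim_ge => m _ _; rewrite lee_fin outer_content_ge0.
move: S0 Sfin Sn; case: (\sum_(i <oo) _)%E => // S _ _ Sn.
have /choice[c cP] m : exists c, covered (A m) c /\
    c <= outer_content (A m) + e / 2 ^+ m.+1.
  have [|c Ac /ltW ce] := @outer_content_adherent (A m) (e / 2 ^+ m.+1).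
    by rewrite divr_gt0// exprn_gt0.
  by exists c.
(* The slacks [e / 2 ^+ m.+1] add up to less than [e]; the exact remainder makes the induction go
   through. *)
have geo n : \sum_(m < n) (e / 2 ^+ m.+1) = e - e / 2 ^+ n.
  elim: n => [|n IH]; first by rewrite big_ord0 expr0 divr1 subrr.
  rewrite big_ord_recr/= IH exprS invfM.
  have : (2^-1 : R) * 2 = 1 by rewrite mulVf.
  by set a := (2 ^+ n)^-1; set b := 2^-1 => b2; nra.
rewrite -EFinD lee_fin; apply: outer_content_le.
apply: (@covered_bigcup A c) => [m|n]; first by case: (cP m).
have := Sn n; rewrite sumEFin lee_fin => Sn'.
apply: le_trans (_ : \sum_(m < n) (outer_content (A m) + e / 2 ^+ m.+1) <= _).
  by apply: ler_sum => m _; case: (cP m).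
rewrite big_split/= geo lerD//.
by rewrite lerBlDr lerDl divr_ge0 ?exprn_ge0// ltW.
Qed.

(* A cover [u] of [A] splits into [u * phi_n] and [u * (1 - phi_k)], where
   [phi_n = min 1 (n f)] increases to the indicator of [f > 0]; freezing [k] keeps
   the second sequence increasing and wastes at most [e]. *)
Lemma outer_content_cozero (f : X -> R) (A : set X) :
  Cb R X f -> (forall x, 0 <= f x) ->
  outer_content (A `&` [set x | 0 < f x]) +
  outer_content (A `&` ~` [set x | 0 < f x]) <= outer_content A.
Proof.
move=> Cf f0; apply: le_outer_content => c [u [Cu u0 ui uA Lu]].
pose phi_ n : X -> R := cst 1 \min (fun x => n%:R * f x).
have Cphi n : Cb R X (phi_ n) by apply: Cb_min; [exact: Cb_cst|exact: Cb_scale].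
have phi0 n x : 0 <= phi_ n x by rewrite /phi_/= le_min ler01 mulr_ge0.
have phi1 n x : phi_ n x <= 1 by rewrite /phi_/= ge_min lexx.
have phii x n p : (n <= p)%N -> phi_ n x <= phi_ p x.
  move=> np; rewrite /phi_/= le_min !ge_min lexx/= ler_wpM2r ?ler_nat ?orbT//.
have Cup n p : Cb R X (u n \* phi_ p) by exact: Cb_mul.
pose M := sup [set L (u n \* phi_ n) | n in setT].
have ubM : has_ubound [set L (u n \* phi_ n) | n in setT].
  exists c => _ [n _ <-]; apply: le_trans (Lu n).
  by apply: functional_le => // x /=; rewrite ler_piMr.
have M_ge n : L (u n \* phi_ n) <= M by apply: ub_le_sup => //; exists n.
apply/ler_addgt0Pl => e e0.
(* With [k] within [e] of the supremum, [M] bounds the first cover and [c - (M - e)] the second; the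
   two costs add up to [c + e]. *)
have [_ [k _ <-] kM] : exists2 z, [set L (u n \* phi_ n) | n in setT] z & M - e < z.
  apply: sup_adherent => //; split => //.
  by exists (L (u 0%N \* phi_ 0%N)), 0%N.
have -> : e + c = M + (c - (M - e)) by ring.
apply: lerD; apply: outer_content_le.
- exists (fun n => u n \* phi_ n); split=> //.
  + by move=> n x /=; rewrite mulr_ge0.
  + by move=> x n p np /=; rewrite ler_pM ?ui ?phii.
  + move=> x [/uA[n un] /= fx].
    (* Beyond the inverse of [f x] the cut-off equals 1 at [x], and beyond [n] the cover is at least
       1 there. *)
    exists (maxn n (Num.truncn (f x)^-1).+1).
    have -> : phi_ (maxn n (Num.truncn (f x)^-1).+1) x = 1.
      apply/eqP; rewrite eq_le phi1/= /phi_/= le_min lexx/=.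
      rewrite -ler_pdivrMr// div1r.
      apply: le_trans (ltW (truncnS_gt _)) _.
      by rewrite ler_nat leq_maxr.
    by rewrite mulr1 (le_trans un)// ui// leq_maxl.
- exists (fun n x => u n x - (u n \* phi_ k) x); split.
  + by move=> n; exact: Cb_sub.
  + by move=> n x /=; rewrite subr_ge0 ler_piMr.
  + move=> x n p np /=; have := ui x n p np; have := phi1 k x; nra.
  + move=> x [/uA[n un] /negP/=]; rewrite -leNgt => fx; exists n.
    rewrite /phi_/=; have -> : f x = 0 by apply/eqP; rewrite eq_le fx f0.
    by rewrite mulr0 (min_idPr ler01) mulr0 subr0.
  (* From [k] on, [L (u n \* phi_ k)] is at least [L (u k \* phi_ k) > M - e]; smaller indices
     follow by monotonicity. *)
  + have Lk n : (k <= n)%N -> L (fun x => u n x - (u n \* phi_ k) x) <= c - (M - e).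
      move=> kn; rewrite functional_sub// lerB// (le_trans (ltW kM))//.
      by apply: functional_le => // x /=; rewrite ler_wpM2r// ui.
    move=> n; apply: le_trans (Lk (maxn k n) (leq_maxl _ _)).
    apply: functional_le; [exact: Cb_sub|exact: Cb_sub|move=> x /=].
    have := ui x n (maxn k n) (leq_maxr _ _); have := phi1 k x; nra.
Qed.

Hypothesis L_daniell : daniell_continuous L.

(** For a cover [u] of [A], the positive parts of [v - u n] decrease to 0: on [A] because [u n]
    reaches 1, off [A] because [v <= 0]. Daniell continuity makes their [L] small, and [v] is at
    most [u n] plus this part. *)
Lemma le_outer_content_indic (v : X -> R) A : Cb R X v ->
  (forall x, v x <= \1_A x) -> L v <= outer_content A.
Proof.
move=> Cv vA; apply: le_outer_content => c [u [Cu u0 ui uA Lu]].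
pose w n : X -> R := (fun x => v x - u n x) \max cst 0.
have Cw n : Cb R X (w n) by apply: Cb_max; [exact: Cb_sub|exact: Cb_cst].
apply/ler_addgt0Pr => e e0.
have [|||n wn] := L_daniell Cw _ _ _ e0.
- by move=> n x; rewrite /w/= le_max lexx orbT.
- by move=> x n p np; rewrite /w/= ge_max !le_max lerB ?ui//= lexx orbT.
- move=> x d d0; have [/uA[n un]|nAx] := pselect (A x); [exists n|exists 0%N];
    rewrite /w/= ge_max (ltW d0) andbT; apply: le_trans (ltW d0);
    rewrite subr_le0; have := vA x; rewrite indicE.
  + by move=> /le_trans; apply; case: (x \in A); rewrite //= (le_trans ler01).
  + by rewrite memNset// => /le_trans; apply.
- apply: le_trans (lerD (Lu n) wn).
  rewrite -L_linear.1//; apply: functional_le => //; first exact: Cb_add.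
  by move=> x; rewrite /w /= -lerBlDl le_max lexx.
Qed.

End daniell.

(** * Horizontal slices of a nonnegative function *)

Section layer_cake.
Context {R : realType} {X : Type}.
Implicit Types (g : X -> R) (d : R).

Definition layer g d (i : nat) : X -> R := fun x =>
  Num.min (g x) (i.+1%:R * d) - Num.min (g x) (i%:R * d).

Lemma sum_layer g d n x : 0 <= g x -> g x <= n%:R * d ->
  \sum_(i < n) layer g d i x = g x.
Proof.
move=> g0 gn; rewrite -(big_mkord xpredT (fun i => layer g d i x)) telescope_sumr//.
by rewrite (min_idPl gn) mul0r (min_idPr g0) subr0.
Qed.

Lemma layer_le g d i x : 0 <= d -> layer g d i x <= d * \1_[set y | i%:R * d < g y] x.
Proof.
move=> d0; rewrite /layer indicE -natr1 mulrDl mul1r.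
have [ig|gi] := ltP (i%:R * d) (g x).
- rewrite mem_set//= mulr1 lerBlDl ge_min.
  by rewrite lexx orbT.
- rewrite memNset/= ?mulr0; last by apply/negP; rewrite -leNgt.
  by rewrite subr_le0 ge_min lexx.
Qed.

(** Every level [i * d] strictly below [g x] contributes [d]. All but the topmost such slice are
    completely filled, so the overshoot is at most one step [d]. *)
Lemma sum_superlevel_le g d n x : 0 <= d -> 0 <= g x ->
  \sum_(i < n) d * \1_[set y | i%:R * d < g y] x <= g x + d.
Proof.
move=> d0 g0; elim: n => [|n IH]; first by rewrite big_ord0 addr_ge0.
have [ng|gn] := ltP (n%:R * d) (g x).
- apply: le_trans (_ : \sum_(i < n.+1) d <= _).
    by apply: ler_sum => i _; rewrite indicE ler_piMr//; case: (_ \in _).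
  by rewrite sumr_const card_ord -mulr_natl -natr1 mulrDl mul1r lerD2r ltW.
- rewrite big_ord_recr/= indicE memNset/= ?mulr0 ?addr0//.
  by apply/negP; rewrite -leNgt.
Qed.

End layer_cake.

(** * Representation of a Daniell functional by a Borel probability *)

Section riesz.
Context {R : realType} {X : ptopologicalType}.
Variable L : (X -> R) -> R.
Hypothesis L_linear : linear_on (Cb R X) L.
Hypothesis L_ge0 : forall f, Cb R X f -> (forall x, 0 <= f x) -> 0 <= L f.
Hypothesis L1 : L (cst 1) = 1.

Definition outer_content_measure : {outer_measure set X -> \bar R} :=
  HB.pack (fun A => (outer_content L A)%:E)
    (isOuterMeasure.Build R X (fun A => (outer_content L A)%:E)
      (congr1 EFin (outer_content0 L_linear L_ge0 L1))
      (fun A => outer_content_ge0 L_ge0 L1 A)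
      (fun A B AB => outer_content_mono L_ge0 L1 AB)
      (outer_content_sigma_subadditive L_linear L_ge0 L1)).

Hypothesis open_cozero : forall U : set X, open U ->
  exists f, [/\ Cb R X f, forall x, 0 <= f x & U = [set x | 0 < f x]].

(** The Caratheodory sets form a sigma-algebra, so open sets suffice; these are cozero sets, which
    [outer_content_cozero] handles. *)
Lemma borel_caratheodory (A : set (borel X)) :
  measurable A -> outer_content_measure.-caratheodory A.
Proof.
move: A; apply: smallest_sub.
  exact: (@sigma_algebra_measurable _ (caratheodory_type outer_content_measure)).
move=> U /open_cozero[f [Cf f0 ->]]; apply: le_caratheodory_measurable => A.
by rewrite -EFinD lee_fin; exact: outer_content_cozero.
Qed.

Lemma borel_sigma_additive :
  semi_sigma_additive (fun A : set (borel X) => (outer_content L A)%:E).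
Proof.
move=> A mA tA mbigcupA.
apply: (@caratheodory_measure_sigma_additive _ _ outer_content_measure) => //.
- by move=> i; exact: borel_caratheodory.
- exact: borel_caratheodory.
Qed.

Hypothesis L_daniell : daniell_continuous L.

Lemma outer_contentT : outer_content L setT = 1.
Proof.
apply/eqP; rewrite eq_le outer_content_le//=; last exact: covered_cst1.
rewrite -[leLHS]L1; apply: le_outer_content_indic => //; first exact: Cb_cst.
by move=> x; rewrite indicE in_setT.
Qed.

Lemma outer_content_probability : exists mu : probability (borel X) R,
  forall A, mu A = (outer_content L A)%:E.
Proof.
pose mu : {measure set (borel X) -> \bar R} :=
  HB.pack (fun A : set (borel X) => (outer_content L A)%:E)
  (isMeasure.Build _ (borel X) R (fun A => (outer_content L A)%:E)
    (outer_measure0 outer_content_measure)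
    (outer_measure_ge0 outer_content_measure)
    borel_sigma_additive).
pose P : probability (borel X) R :=
  HB.pack (mu : set (borel X) -> \bar R) (Measure.on mu)
    (Measure_isProbability.Build _ (borel X) R mu (congr1 EFin outer_contentT)).
by exists P.
Qed.

(** Slice [g] into layers of height [d]. Each costs at most [d] times the content of its superlevel
    set, and these products add up to an integral of at most [expect mu g + d]; [d] is arbitrary. *)
Lemma functional_le_expect (mu : probability (borel X) R) g :
  (forall A, mu A = (outer_content L A)%:E) ->
  Cb R X g -> (forall x, 0 <= g x) -> L g <= expect mu g.
Proof.
move=> muE Cg g0; have [M M0 gM] := Cb_bounds Cg.
apply/ler_addgt0Pr => d d0.
(* Enough layers for [n * d] to exceed the bound [M] of [g]. *)
pose n := (Num.truncn (M / d)).+1.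
have gn x : g x <= n%:R * d.
  have /andP[_ /le_trans] := gM x; apply.
  by rewrite -ler_pdivrMr// ltW// truncnS_gt.
pose A i := [set y | i%:R * d < g y].
have Clayer i : Cb R X (layer g d i).
  by apply: Cb_sub; apply: Cb_min => //; exact: Cb_cst.
have mA i : measurable (A i : set (borel X)).
  have -> : A i = [set: borel X] `&` g @^-1` `]i%:R * d, +oo[%classic.
    by rewrite setTI; apply/seteqP; split=> y /=; rewrite in_itv/= andbT.
  exact: (Cb_measurable Cg).
have layers : L g <= \sum_(i < n) d * outer_content L (A i).
  have -> : g = (fun x => \sum_(i < n) layer g d i x).
    by apply/funext => x; rewrite sum_layer.
  rewrite (functional_sum L_linear L1 n Clayer); apply: ler_sum => i _.
  rewrite -ler_pdivrMl// -L_linear.2//.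
  apply: le_outer_content_indic => //; first exact: Cb_scale.
  by move=> x; rewrite ler_pdivrMl// layer_le// ltW.
apply: (le_trans layers).
have Cgd : Cb R X (g \+ cst d) by apply: Cb_add => //; exact: Cb_cst.
have <- : expect mu (g \+ cst d) = expect mu g + d.
  by rewrite (expect_linear mu).1//; [rewrite expect_cst|exact: Cb_cst].
rewrite -lee_fin -expectE//.
have -> : (\sum_(i < n) d * outer_content L (A i))%:E =
    (\int[mu]_(x in [set: borel X]) \sum_(i < n) (d * \1_(A i) x)%:E)%E.
  rewrite ge0_integral_sum//.
  - rewrite -sumEFin; apply: eq_bigr => i _.
    under eq_integral do rewrite EFinM.
    rewrite ge0_integralZl_EFin//; last exact: ltW.
    + by rewrite integral_indic// setIT EFinM; congr (_ * _)%E; symmetry; exact: muE.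
    + by apply/measurable_EFinP; exact: measurable_indic.
  - move=> i; apply/measurable_EFinP; apply: measurable_funM => //.
  - by move=> i x _; rewrite lee_fin mulr_ge0// ltW.
apply: ge0_le_integral => //.
- by move=> x _; apply: sume_ge0 => i _; rewrite lee_fin mulr_ge0// ltW.
- apply: emeasurable_sum => i; apply/measurable_EFinP; apply: measurable_funM => //.
- by apply/measurable_EFinP; exact: Cb_measurable.
- by move=> x _; rewrite sumEFin lee_fin sum_superlevel_le// ltW.
Qed.

(* The reverse inequality is the same one applied to [M - g], where [g <= M]. *)
Theorem riesz_representation : exists mu : probability (borel X) R,
  forall g, Cb R X g -> L g = expect mu g.
Proof.
have [mu muE] := outer_content_probability.
suff le_expect g : Cb R X g -> L g <= expect mu g.
  exists mu => g Cg; apply/eqP; rewrite eq_le le_expect//=.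
  have := le_expect _ (Cb_scale (-1) Cg).
  by rewrite L_linear.2// (expect_linear mu).2// !mulN1r lerN2.
move=> Cg; have [M M0 gM] := Cb_bounds Cg.
have CM : Cb R X (cst M) by exact: Cb_cst.
have := @functional_le_expect mu (g \+ cst M) muE (Cb_add Cg CM).
rewrite L_linear.1// (expect_linear mu).1// expect_cst.
rewrite (functional_cst L_linear L1) lerD2r; apply => x /=.
by have /andP[+ _] := gM x; rewrite -subr_ge0 opprK.
Qed.

End riesz.

(** * Metric and compactness arguments: cozero sets, Dini, tightness *)

(** The function is the distance to the complement of [U] capped at 1; the triangle inequality makes
    it 1-Lipschitz. *)
Lemma polish_open_cozero (R : realType) (X : topologicalType) (U : set X) :
  polish_space R X -> open U ->
  exists f : X -> R, [/\ Cb R X f, forall x, 0 <= f x & U = [set x | 0 < f x]].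
Proof.
move=> [[d [d0 dC dT dN _]] _] oU.
have d_ge0 x y : 0 <= d x y.
  by have := dT x y x; rewrite (d0 x x).2// (dC y x); lra.
(* Adjoining 1 keeps the set nonempty when [U] is the whole space. *)
pose S x := [set r | r = 1 \/ exists2 y, ~ U y & r = d x y].
pose f x := inf (S x).
have S0 x : S x !=set0 by exists 1; left.
have lbS x : has_lbound (S x) by exists 0 => _ [->|[y _ ->]].
have f0 x : 0 <= f x by apply: lb_le_inf => // _ [->|[y _ ->]].
have f1 x : f x <= 1 by apply: ge_inf => //; left.
have fd x z : f x - d x z <= f z.
  apply: lb_le_inf => // _ [->|[y Uy ->]].
    by have := f1 x; have := d_ge0 x z; lra.
  have : f x <= d x y by apply: ge_inf => //; right; exists y.
  by have := dT x z y; lra.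
exists f; split=> //.
- apply/CbP; split; last by exists 1 => x; rewrite ger0_norm.
  move=> x; apply/cvgrPdist_lt => e e0; apply/dN; exists e => // y /= dxy.
  by rewrite ltr_norml; have := fd x y; have := fd y x; rewrite (dC y x); lra.
- apply/seteqP; split=> x /=.
  + move=> Ux; have /dN[e e0 eU] : nbhs x U by exact: open_nbhs_nbhs.
    apply: (@lt_le_trans _ _ (Num.min e 1)); first by rewrite lt_min e0 ltr01.
    apply: lb_le_inf => // _ [->|[y Uy ->]]; first by rewrite ge_min lexx orbT.
    rewrite ge_min; apply/orP; left; rewrite leNgt; apply/negP => dxy.
    exact/Uy/eU.
  + move=> fx; apply: contrapT => Ux; move: fx; apply/negP; rewrite -leNgt.
    by apply: ge_inf => //; right; exists x => //; apply/esym/d0.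
Qed.

(** Near each point of [K] some [u n] is below [d] by continuity, and so are all later ones by
    monotonicity; compactness makes the index uniform. *)
Lemma dini (R : realType) (X : topologicalType) (K : set X) (u : nat -> X -> R) d :
  compact K -> (forall n, continuous (u n)) ->
  (forall x, {homo u ^~ x : m n / (m <= n)%N >-> n <= m}) ->
  (forall x e, 0 < e -> exists n, u n x <= e) -> 0 < d ->
  exists n, forall x, K x -> u n x <= d.
Proof.
move=> /compact_near_coveringP cK cu ui u0 d0.
have [x Kx|n _ nK] := cK nat \oo (fun n x => u n x <= d) _; last first.
  by exists n => x Kx; apply: (nK n) => /=.
have [n un] := u0 x (d / 2) (divr_gt0 d0 (ltr0n _ 2)).
have nx : nbhs x [set y | u n y < d].
  have und : u n x < d by lra.
  exact: (cvgr_lt _ (cu n x) _ und).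
exists ([set y | u n y < d], [set m | (n <= m)%N]) => /=.
  by split=> //; exists n.
by move=> [y m] [/= ynd nm]; apply: le_trans (ui y _ _ nm) (ltW ynd).
Qed.

(** Some [u n] is at most [e / 2 + M * h]: on [K] by Dini, with [h >= 0], and off [K] because
    [u n <= u 0 <= M] and [h >= 1]. *)
Lemma tight_daniell_continuous (R : realType) (X : topologicalType) (L : (X -> R) -> R) :
  linear_on (Cb R X) L ->
  (forall f, Cb R X f -> (forall x, 0 <= f x) -> 0 <= L f) ->
  L (cst 1) = 1 ->
  (forall e, 0 < e -> exists h K, [/\ Cb R X h, compact K,
     forall x, \1_(~` K) x <= h x & L h <= e]) ->
  daniell_continuous L.
Proof.
move=> LL L0 L1 tightL u Cu u0 ui uv e e0.
have [M M0 uM] := Cb_bounds (Cu 0%N).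
(* The level [e / 2 / M] lets the term [M * h] contribute at most [e / 2]. *)
have [|h [K [Ch cK hK Lh]]] := tightL (e / 2 / M); first by rewrite !divr_gt0.
have [|n nK] := @dini _ _ K u (e / 2) cK (fun n => (Cu n).1) ui uv.
  by rewrite divr_gt0.
have CM : Cb R X (fun x => M * h x) by exact: Cb_scale.
have Ce : Cb R X (cst (e / 2)) by exact: Cb_cst.
exists n; apply: (@le_trans _ _ (L (cst (e / 2) \+ (fun x => M * h x)))).
  apply: (functional_le LL L0) => //; first exact: Cb_add.
  move=> x /=; have := hK x; rewrite indicE; have [Kx|Kx] := pselect (K x).
  - rewrite memNset/=; last by apply.
    by move=> hx; have := nK x Kx; have := mulr_ge0 (ltW M0) hx; lra.
  - rewrite mem_set//= => hx; have := ui x 0%N n isT => /= un0.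
    by have /andP[_ u0M] := uM x; nra.
rewrite LL.1// (functional_cst LL L1) LL.2//.
have : M * L h <= M * (e / 2 / M) by rewrite ler_pM2l.
rewrite [M * (_ / _)]mulrC divfK ?gt_eqF//; lra.
Qed.

(** * The superhedging price as a real sublinear functional *)

Section superhedging.
Context {R : realType} {X : ptopologicalType} (mu0 : probability (borel X) R).
Variable H : set (X -> R).
Hypothesis HCb : H `<=` Cb R X.
Hypothesis Hlin : linear_space H.
Hypothesis Hcst : contains_constants H.
Implicit Types f h : X -> R.

(** Real-valued form of [phi], as Hahn-Banach requires. For [f] in [Cb], constants in [H] make the
    set nonempty and a lower bound of [f] bounds it below, so [inf] is not a default value. *)
Definition superhedging f : R :=
  inf [set expect mu0 h | h in [set h | H h /\ forall x, f x <= h x]].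

Let ne f : Cb R X f ->
  [set expect mu0 h | h in [set h | H h /\ forall x, f x <= h x]] !=set0.
Proof.
move=> Cf; have [M M0 fM] := Cb_bounds Cf.
exists (expect mu0 (cst M)), (cst M) => //; split=> // x.
by have /andP[] := fM x.
Qed.

Let lb f : Cb R X f -> has_lbound
  [set expect mu0 h | h in [set h | H h /\ forall x, f x <= h x]].
Proof.
move=> Cf; have [M M0 fM] := Cb_bounds Cf; exists (- M) => _ [h [Hh fh] <-].
rewrite -(expect_cst mu0 (- M)); apply: expect_le; [exact: Cb_cst|exact: HCb|].
by move=> x; have /andP[+ _] := fM x => /le_trans; apply.
Qed.

Lemma superhedging_le f h : Cb R X f -> H h -> (forall x, f x <= h x) ->
  superhedging f <= expect mu0 h.
Proof. by move=> Cf Hh fh; apply: ge_inf; [exact: lb|exists h]. Qed.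

Lemma superhedging_sublinear : sublinear_on (Cb R X) superhedging.
Proof.
have [H0 HD HZ] := Hlin; have [ED EZ] := expect_linear mu0.
split=> [f g Cf Cg|a f a0 Cf].
- apply: le_infD; [exact: ne|exact: ne|move=> _ _ [h [Hh fh] <-] [k [Hk gk] <-]].
  rewrite -ED; [|exact: HCb|exact: HCb].
  apply: superhedging_le; [exact: Cb_add|exact: HD|].
  by move=> x /=; rewrite lerD.
- apply: le_infZ => //; first exact: ne.
  move=> _ [h [Hh fh] <-]; rewrite -EZ; last exact: HCb.
  apply: superhedging_le; [exact: Cb_scale|exact: HZ|].
  by move=> x; rewrite ler_wpM2l.
Qed.

Lemma phi_le_superhedging f : Cb R X f ->
  (phi mu0 H f <= (superhedging f)%:E)%E.
Proof.
move=> Cf; apply/lee_addgt0Pr => e e0.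
have [_ [h [Hh fh] <-] he] := inf_adherent e0 (conj (ne Cf) (lb Cf)).
rewrite -EFinD; apply: (@le_trans _ _ (expect mu0 h)%:E); last first.
  by rewrite lee_fin ltW.
apply: ereal_inf_lbound; exists h => //; rewrite expectE//; exact: HCb.
Qed.

End superhedging.

(** * Dependence of the price on the set of hedges *)

Lemma phi_subset (R : realType) (X : ptopologicalType)
    (mu0 : probability (borel X) R) (A B : set (X -> R)) f :
  A `<=` B -> (phi mu0 B f <= phi mu0 A f)%E.
Proof.
move=> AB; apply: ereal_inf_le_tmp => _ [h [Ah fh] <-].
by exists h => //; split=> //; exact: AB.
Qed.

(** The infimum over a union is the infimum of the infima. These decrease with [m], possibly from
    [+oo], and so converge to it in the extended reals. *)
Lemma phi_bigcup_cvg (R : realType) (X : ptopologicalType)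
    (mu0 : probability (borel X) R) (A : nat -> set (X -> R)) f :
  (forall m, A m `<=` A m.+1) ->
  phi mu0 (A m) f @[m --> \oo] --> phi mu0 (\bigcup_m A m) f.
Proof.
move=> incrA.
have -> : phi mu0 (\bigcup_m A m) f = ereal_inf (range (fun m => phi mu0 (A m) f)).
  apply/eqP; rewrite eq_le; apply/andP; split.
  - apply: le_ereal_inf_tmp => _ [m _ <-]; apply: phi_subset => h Ah; by exists m.
  - apply: le_ereal_inf_tmp => _ [h [[m _ Ah] fh] <-].
    apply: (@le_trans _ _ (phi mu0 (A m) f)).
      by apply: ereal_inf_lbound; exists m.
    by apply: ereal_inf_lbound; exists h.
apply: ereal_nonincreasing_cvgn; apply/nonincreasing_seqP => m.
exact: phi_subset.
Qed.

(** * Equality of the prices over [Hoo] and over [H] *)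

Theorem proposition2p3 (R : realType) (X : ptopologicalType)
  (polishX : polish_space R X)
  (mu0 : probability (borel X) R)
  (H : set (X -> R))
  (HCb : H `<=` Cb R X)
  (Hlin : linear_space H)
  (Hcst : contains_constants H)
  (phi_cont : continuous_from_above (phi mu0 H))
  (Hm : nat -> set (X -> R))
  (Hm_sub : forall m, Hm m `<=` H)
  (Hm_incr : forall m, Hm m `<=` Hm m.+1)
  (Hoo_lin : linear_space (\bigcup_m Hm m))
  (Hoo_cst : contains_constants (\bigcup_m Hm m))
  (HD : condition_D H (\bigcup_m Hm m)) :
  forall f : X -> R, Cb R X f ->
    phi mu0 (Hm m) f @[m --> \oo] --> phi mu0 (\bigcup_m Hm m) f /\
    phi mu0 (\bigcup_m Hm m) f = phi mu0 H f.
Proof.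
move=> f Cf; split; first exact: phi_bigcup_cvg.
set Hoo := \bigcup_m Hm m in Hoo_lin Hoo_cst HD *.
have HooH : Hoo `<=` H by move=> h [m _ /Hm_sub].
have HooCb : Hoo `<=` Cb R X by move=> h /HooH/HCb.
have [L [LL Lp Lf]] := hahn_banach Cb_linear_space
  (superhedging_sublinear mu0 HooCb Hoo_lin Hoo_cst) Cf.
have [_ _ HooZ] := Hoo_lin.
have JL := expect_linear mu0.
(* If [g >= 0], the constant 0 in [Hoo] dominates [- g], so the price of [- g], and with it
   [L (- g)], is at most 0. *)
have L_ge0 g : Cb R X g -> (forall x, 0 <= g x) -> 0 <= L g.
  move=> Cg g0; have CNg := Cb_scale (-1) Cg.
  rewrite -oppr_le0 -mulN1r -LL.2//; apply: le_trans (Lp _ CNg) _.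
  rewrite -(expect_cst mu0 0); apply: superhedging_le => // x.
  by rewrite mulN1r oppr_le0.
have LE h : Hoo h -> L h = expect mu0 h.
  move=> Hh; have le_expect k : Hoo k -> L k <= expect mu0 k.
    move=> Hk; have Ck := HooCb _ Hk.
    by apply: le_trans (Lp _ Ck) _; apply: superhedging_le.
  apply/eqP; rewrite eq_le le_expect//=.
  have := le_expect _ (HooZ (-1) _ Hh); have Ch := HooCb _ Hh.
  by rewrite LL.2// JL.2// !mulN1r lerN2.
(* A measure representing the average controls [L] and [mu0] together, so one approximation in its
   L1 norm serves both. *)
pose L' g := (L g + expect mu0 g) / 2.
have L'L : linear_on (Cb R X) L'.
  split=> [g h Cg Ch|a g Cg]; rewrite /L'.
  - by rewrite LL.1// JL.1//; field.
  - by rewrite LL.2// JL.2//; field.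
have J_ge0 g : Cb R X g -> (forall x, 0 <= g x) -> 0 <= expect mu0 g.
  move=> Cg g0; rewrite -(expect_cst mu0 0); apply: expect_le => //.
  exact: Cb_cst.
have L'_ge0 g : Cb R X g -> (forall x, 0 <= g x) -> 0 <= L' g.
  by move=> Cg g0; rewrite divr_ge0// addr_ge0 ?L_ge0 ?J_ge0.
have L'E h : Hoo h -> L' h = expect mu0 h.
  by move=> Hh; rewrite /L' LE//; field.
have L'1 : L' (cst 1) = 1 by rewrite L'E ?expect_cst.
have [||nu nuE] := @riesz_representation _ _ _ L'L L'_ge0 L'1.
- by move=> U; exact: polish_open_cozero.
- apply: tight_daniell_continuous => // e e0.
  (* The majorant [h] lies in [Hoo], where [L'] and [mu0] agree, so tightness of [mu0] passes to
     [L']. *)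
  have [_ [h Hh [K [cK Kh]]]] := HD e mu0 e0.
  have Ch := HooCb _ Hh.
  rewrite expectE// lee_fin -L'E// => L'h.
  by exists h, K.
have LEH h : H h -> L h = expect mu0 h.
  move=> Hh; have Ch := HCb _ Hh.
  apply/eqP; rewrite -subr_eq0 -normr_le0; apply/ler_addgt0Pl => e e0.
  (* Undoing the average doubles the error: the errors under [L] and [mu0] together are at most
     [2 * (e / 2) = e]. *)
  rewrite addr0; have e20 : 0 < e / 2 by rewrite divr_gt0.
  have [/(_ h Hh)[h' Hh' hh'] _] := HD (e / 2) nu e20.
  have Ch' := HooCb _ Hh'.
  have Cd : Cb R X (fun x => h x - h' x) by exact: Cb_sub.
  have Cn := Cb_norm Cd.
  move: hh'; rewrite expectE// lee_fin -nuE// /L' => hh'.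
  have abs_le (F : (X -> R) -> R) : linear_on (Cb R X) F ->
      (forall g, Cb R X g -> (forall x, 0 <= g x) -> 0 <= F g) ->
      `|F h - F h'| <= F (fun x => `|h x - h' x|).
    move=> FL F0; rewrite -(functional_sub FL)// ler_norml; apply/andP; split.
    - rewrite -mulN1r -FL.2//; apply: (functional_le FL F0) => //; first exact: Cb_scale.
      by move=> x; rewrite mulN1r lerNl -normrN ler_norm.
    - by apply: (functional_le FL F0) => // x; exact: ler_norm.
  (* Since [L h' = expect mu0 h'], the triangle inequality through this common value bounds the
     distance from [L h] to [expect mu0 h] by [e]. *)
  have := abs_le _ LL L_ge0; have := abs_le _ JL J_ge0; rewrite (LE _ Hh').
  rewrite !ler_norml => /andP[? ?] /andP[? ?]; apply/andP; split; lra.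
apply/eqP; rewrite eq_le (phi_subset _ _ HooH) andbT.
apply: le_trans (phi_le_superhedging mu0 HooCb Hoo_cst Cf) _.
(* For a hedge [h] of [f] in [H], the price over [Hoo] is [L f], and positivity gives
   [L f <= L h = expect mu0 h]. *)
apply: le_ereal_inf_tmp => _ [h [Hh fh] <-]; have Ch := HCb _ Hh.
rewrite expectE// lee_fin -Lf -LEH//.
exact: (functional_le LL L_ge0).
Qed.
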